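(* Let $\mathfrak{D}$ be a concrete domain whose domain $D$ is infinite and which satisfies JD. Then the consistency problem for $\mathcal{ALCSCC}^{++}(\mathfrak{D})$ TBoxes is undecidable.
   Context: A concrete domain $\mathfrak{D}=(D,P_1^D,\dots)$ is a relational structure over a countable signature. JD: there is a quantifier-free, equality-free first-order formula $\phi_=(x,y)$ over the signature of $\mathfrak{D}$ defining equality on $D$. Feature roles are $P(\alpha_1,\dots,\alpha_k)$ with $P$ a $k$-ary predicate of $\mathfrak{D}$ and each $\alpha_i$ of the form $f$ or $\partial f$ with $f$ a feature name; in an interpretation, $(d,e)\in P(\alpha_1,\dots,\alpha_k)^\mathcal{I}$ iff $(c_1,\dots,c_k)\in P^D$ where $c_i=f_i^\mathcal{I}(d)$ if $\alpha_i=f_i$ and $c_i=f_i^\mathcal{I}(e)$ if $\alpha_i=\partial f_i$ (features are partial functions into $D$). QFBAPA constraints: set constraints $s\subseteq t$, $s=t$ over set terms built from set variables, $\emptyset$, $\mathcal{U}$ using $\cap,\cup,{}^c$, and numerical constraints $\ell=\ell'$, $\ell<\ell'$, $n\mathrel{\mathsf{div}}\ell$ over PA expressions $n_0+n_1|s_1|+\dots+n_k|s_k|$. $\mathcal{ALCSCC}^{++}(\mathfrak{D})$ concepts are concept names, $\neg C$, $C\sqcap D$, concrete-domain restrictions $\exists p_1,\dots,p_k.P$ ($p_i$ of form $f$ or $rf$), and $\mathsf{sat}(\mathfrak{con})$ where $\mathfrak{con}$ is a set or numerical constraint whose set variables are role names, concepts and feature roles. Interpretations are finite; $d\in\mathsf{sat}(\mathfrak{con})^\mathcal{I}$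 iff $\mathfrak{con}$ is satisfied by the assignment with $\mathcal{U}\mapsto\Delta^\mathcal{I}$, $r\mapsto r^\mathcal{I}(d)=\{e\mid (d,e)\in r^\mathcal{I}\}$, $C\mapsto C^\mathcal{I}$, $\gamma\mapsto\{e\mid(d,e)\in\gamma^\mathcal{I}\}$. A TBox is a finite set of CIs $C\sqsubseteq D$; it is consistent if it has a finite model. *)

(* Defs.v *)
From HB Require Import structures.
From mathcomp Require Import all_boot.
From mathcomp Require Import boolp.
From mathcomp Require classical_sets cardinality.

Set Implicit Arguments.
Unset Strict Implicit.
Unset Printing Implicit Defensive.

(** * Concrete domains *)

(* No computability is assumed of [pickle] or of [arity]. *)
Record concrete_domain := ConcreteDomain {
  carrier :> Type;
  predicate : countType;
  arity : predicate -> nat;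
  pred_interp : forall P : predicate, (arity P).-tuple carrier -> Prop }.

Definition infinite_domain (D : concrete_domain) : Prop :=
  cardinality.infinite_set (@classical_sets.setT D).

(* There is no equality atom and there are no quantifiers; [V] is the type of
   the variables that may occur. *)
Inductive qf_formula (D : concrete_domain) (V : Type) : Type :=
  | QFAtom (P : predicate D) (vs : (arity P).-tuple V)
  | QFNot (phi : qf_formula D V)
  | QFAnd (phi psi : qf_formula D V)
  | QFOr (phi psi : qf_formula D V).

Fixpoint qf_holds (D : concrete_domain) (V : Type) (env : V -> D)
    (phi : qf_formula D V) : Prop :=
  match phi with
  | QFAtom _ vs => pred_interp (map_tuple env vs)
  | QFNot phi => ~ qf_holds env phi
  | QFAnd phi psi => qf_holds env phi /\ qf_holds env psi
  | QFOr phi psi => qf_holds env phi \/ qf_holds env psi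
  end.

(* The variables x and y are represented by [false] and [true]. *)
Definition JD (D : concrete_domain) : Prop :=
  exists phi : qf_formula D bool,
    forall x y : D, qf_holds (fun v => if v then y else x) phi <-> x = y.

(** * QFBAPA constraints over a type [V] of set variables *)

Inductive set_term (V : Type) : Type :=
  | SVar (v : V)
  | SEmpty
  | SUniv
  | SInter (s t : set_term V)
  | SUnion (s t : set_term V)
  | SCompl (s : set_term V).
Arguments SEmpty {V}.
Arguments SUniv {V}.

(* [PAAdd n1 s1 (.. (PAAdd nk sk (PAConst n0)))] is n0 + n1|s1| + .. + nk|sk| *)
Inductive pa_expr (V : Type) : Type :=
  | PAConst (n : nat)
  | PAAdd (n : nat) (s : set_term V) (l : pa_expr V).
Arguments PAConst {V} n.

Inductive constraint (V : Type) : Type :=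
  | CSub (s t : set_term V)
  | CEqS (s t : set_term V)
  | CEqN (l l' : pa_expr V)
  | CLtN (l l' : pa_expr V)
  | CDiv (n : nat) (l : pa_expr V).

Section QFBAPASemantics.
Variables (V : Type) (U : finType) (asg : V -> {set U}).

Fixpoint set_value (s : set_term V) : {set U} :=
  match s with
  | SVar v => asg v
  | SEmpty => set0
  | SUniv => setT
  | SInter s t => set_value s :&: set_value t
  | SUnion s t => set_value s :|: set_value t
  | SCompl s => ~: set_value s
  end.

Fixpoint pa_value (l : pa_expr V) : nat :=
  match l with
  | PAConst n => n
  | PAAdd n s l => n * #|set_value s| + pa_value l
  end.

Definition satisfied (c : constraint V) : bool :=
  match c with
  | CSub s t => set_value s \subset set_value t
  | CEqS s t => set_value s == set_value t
  | CEqN l l' => pa_value l == pa_value l'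
  | CLtN l l' => pa_value l < pa_value l'
  | CDiv n l => n %| pa_value l
  end.

End QFBAPASemantics.

(** * Syntax of ALCSCC++(D); concept, role and feature names are naturals *)

Inductive feature_arg : Type :=
  | Here (f : nat)    (* f *)
  | There (f : nat).  (* ∂f *)

Inductive feature_role (D : concrete_domain) : Type :=
  | FRole (P : predicate D) (args : (arity P).-tuple feature_arg).

Inductive path : Type :=
  | PFeature (f : nat)
  | PRoleFeature (r f : nat).

Inductive set_var (D : concrete_domain) (C : Type) : Type :=
  | VRole (r : nat)
  | VConcept (c : C)
  | VFRole (g : feature_role D).

Inductive concept (D : concrete_domain) : Type :=
  | CName (A : nat)
  | CNot (C : concept D)
  | CAnd (C1 C2 : concept D)
  | CExists (P : predicate D) (ps : (arity P).-tuple path)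
  | CSat (con : constraint (set_var D (concept D))).

Definition tbox (D : concrete_domain) := seq (concept D * concept D).

(** * Semantics *)

Record interpretation (D : concrete_domain) := Interpretation {
  delta :> finType;
  delta_nonempty : 0 < #|delta|;
  concept_interp : nat -> {set delta};
  role_interp : nat -> {set delta * delta};
  feature_interp : nat -> delta -> option D }.

Section Semantics.
Variables (D : concrete_domain) (I : interpretation D).

Definition feature_arg_value (d e : I) (a : feature_arg) : option D :=
  match a with
  | Here f => feature_interp f d
  | There f => feature_interp f e
  end.

Definition frole_holds (g : feature_role D) (d e : I) : Prop :=
  match g with
  | FRole P args =>
      exists2 c : (arity P).-tuple D,
        forall i, feature_arg_value d e (tnth args i) = Some (tnth c i)
        & pred_interp c
  end.

Definition path_value (d : I) (p : path) (v : D) : Prop :=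
  match p with
  | PFeature f => feature_interp f d = Some v
  | PRoleFeature r f =>
      exists2 e : I, (d, e) \in role_interp I r & feature_interp f e = Some v
  end.

Definition set_var_value (C : Type) (ext : C -> {set I}) (d : I)
    (v : set_var D C) : {set I} :=
  match v with
  | VRole r => [set e | (d, e) \in role_interp I r]
  | VConcept c => ext c
  | VFRole g => [set e | `[< frole_holds g d e >]]
  end.

Fixpoint concept_ext (C : concept D) : {set I} :=
  match C with
  | CName A => concept_interp I A
  | CNot C => ~: concept_ext C
  | CAnd C1 C2 => concept_ext C1 :&: concept_ext C2
  | CExists P ps =>
      [set d | `[< exists2 c : (arity P).-tuple D,
                     forall i, path_value d (tnth ps i) (tnth c i)
                     & pred_interp c >]]
  | CSat con => [set d | satisfied (set_var_value concept_ext d) con]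
  end.

Definition is_model (T : tbox D) : bool :=
  all (fun ci => concept_ext ci.1 \subset concept_ext ci.2) T.

End Semantics.

Definition consistent (D : concrete_domain) (T : tbox D) : Prop :=
  exists I : interpretation D, is_model I T.

(** * Gödel numbering of TBoxes *)

(* Each node is coded as the number of the list of its tag and the codes of its
   children, through the bijection [CodeSeq.code : seq nat -> nat]. *)
Local Notation num := CodeSeq.code.
Local Arguments CodeSeq.code : simpl never.

Section QFBAPACode.
Variables (V : Type) (code_var : V -> nat).

Fixpoint code_set_term (s : set_term V) : nat :=
  match s with
  | SVar v => num [:: 0; code_var v]
  | SEmpty => num [:: 1]
  | SUniv => num [:: 2]
  | SInter s t => num [:: 3; code_set_term s; code_set_term t]
  | SUnion s t => num [:: 4; code_set_term s; code_set_term t]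
  | SCompl s => num [:: 5; code_set_term s]
  end.

Fixpoint code_pa_expr (l : pa_expr V) : nat :=
  match l with
  | PAConst n => num [:: 0; n]
  | PAAdd n s l => num [:: 1; n; code_set_term s; code_pa_expr l]
  end.

Definition code_constraint (c : constraint V) : nat :=
  match c with
  | CSub s t => num [:: 0; code_set_term s; code_set_term t]
  | CEqS s t => num [:: 1; code_set_term s; code_set_term t]
  | CEqN l l' => num [:: 2; code_pa_expr l; code_pa_expr l']
  | CLtN l l' => num [:: 3; code_pa_expr l; code_pa_expr l']
  | CDiv n l => num [:: 4; n; code_pa_expr l]
  end.

End QFBAPACode.

Section Code.
Variable D : concrete_domain.

Definition code_feature_arg (a : feature_arg) : nat :=
  match a with
  | Here f => num [:: 0; f]
  | There f => num [:: 1; f]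
  end.

Definition code_path (p : path) : nat :=
  match p with
  | PFeature f => num [:: 0; f]
  | PRoleFeature r f => num [:: 1; r; f]
  end.

Definition code_set_var (C : Type) (code_c : C -> nat) (v : set_var D C) : nat :=
  match v with
  | VRole r => num [:: 0; r]
  | VConcept c => num [:: 1; code_c c]
  | VFRole (FRole P args) =>
      num [:: 2; pickle P; num [seq code_feature_arg a | a <- args]]
  end.

Fixpoint code_concept (C : concept D) : nat :=
  match C with
  | CName A => num [:: 0; A]
  | CNot C => num [:: 1; code_concept C]
  | CAnd C1 C2 => num [:: 2; code_concept C1; code_concept C2]
  | CExists P ps => num [:: 3; pickle P; num [seq code_path p | p <- ps]]
  | CSat con => num [:: 4; code_constraint (code_set_var code_concept) con]
  end.

Definition code_tbox (T : tbox D) : nat :=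
  num [seq num [:: code_concept ci.1; code_concept ci.2] | ci <- T].

End Code.

(** ** The numbering is injective *)

Lemma num_inj : injective num.
Proof. exact: can_inj CodeSeq.codeK. Qed.

Lemma ltn_num (s : seq nat) (x : nat) : x \in s -> x < num s.
Proof.
elim: s => //= y s IHs; rewrite inE => /predU1P[->|/IHs lt_x].
  by rewrite (leq_trans (ltn_expl y (ltnSn 1)))// leq_pmulr.
rewrite (leq_trans lt_x)// (leq_trans _ (leq_pmull _ (expn_gt0 2 y)))//.
by rewrite -addnn -addnS leq_addr.
Qed.

Section QFBAPACodeInj.
Variables (V : Type) (code_var : V -> nat).

Definition inj_below (n : nat) :=
  forall v v', code_var v < n -> code_var v = code_var v' -> v = v'.

Lemma inj_belowW m n : m <= n -> inj_below n -> inj_below m.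
Proof. by move=> le_mn Hn v v' /leq_trans/(_ le_mn); apply: Hn. Qed.

Ltac sub H := apply: (inj_belowW _ H); apply/ltnW/ltn_num;
  by rewrite !inE eqxx ?orbT.

Lemma code_set_term_inj s s' : inj_below (code_set_term code_var s) ->
  code_set_term code_var s = code_set_term code_var s' -> s = s'.
Proof.
elim: s s' => [v|||s IHs t IHt|s IHs t IHt|s IHs] [v'|||s' t'|s' t'|s'] /= H
  /num_inj //.
- by move=> [/H->//]; apply: ltn_num; rewrite !inE eqxx orbT.
- by move=> [/IHs-> ]; [move=> /IHt->//|]; sub H.
- by move=> [/IHs-> ]; [move=> /IHt->//|]; sub H.
- by move=> [/IHs->//]; sub H.
Qed.

Lemma code_pa_expr_inj l l' : inj_below (code_pa_expr code_var l) ->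
  code_pa_expr code_var l = code_pa_expr code_var l' -> l = l'.
Proof.
elim: l l' => [n|n s l IHl] [n'|n' s' l'] /= H /num_inj //; first by case=> ->.
by move=> [-> /code_set_term_inj->]; [move=> /IHl->//|]; sub H.
Qed.

Lemma code_constraint_inj c c' : inj_below (code_constraint code_var c) ->
  code_constraint code_var c = code_constraint code_var c' -> c = c'.
Proof.
case: c c' => [s t|s t|l1 l2|l1 l2|n l] [s' t'|s' t'|l1' l2'|l1' l2'|n' l'] /=
  H /num_inj //.
- by move=> [/code_set_term_inj->]; [move=> /code_set_term_inj->//|]; sub H.
- by move=> [/code_set_term_inj->]; [move=> /code_set_term_inj->//|]; sub H.
- by move=> [/code_pa_expr_inj->]; [move=> /code_pa_expr_inj->//|]; sub H.
- by move=> [/code_pa_expr_inj->]; [move=> /code_pa_expr_inj->//|]; sub H.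
- by move=> [-> /code_pa_expr_inj->//]; sub H.
Qed.

End QFBAPACodeInj.

Lemma code_feature_arg_inj : injective code_feature_arg.
Proof. by move=> [f|f] [f'|f'] /num_inj // [->]. Qed.

Lemma code_path_inj : injective code_path.
Proof. by move=> [f|r f] [f'|r' f'] /num_inj //; [case=> ->|case=> -> ->]. Qed.

Lemma code_concept_inj (D : concrete_domain) : injective (@code_concept D).
Proof.
move=> C C'; have [n] := ubnP (code_concept C); elim: n C C' => // n IHn C C'.
rewrite ltnS => leCn; have lt s x : x \in s -> num s <= n -> x < n.
  by move=> /ltn_num; apply: leq_trans.
case: C C' leCn => [A|C|C1 C2|P ps|con] [A'|C'|C1' C2'|P' ps'|con'] /= leCn
  /num_inj //.
- by case=> ->.
- by move=> [/IHn->//]; apply: lt leCn; rewrite !inE eqxx ?orbT.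
- move=> [/IHn->]; last by apply: lt leCn; rewrite !inE eqxx ?orbT.
  by move=> /IHn->//; apply: lt leCn; rewrite !inE eqxx ?orbT.
- move=> [/(pcan_inj pickleK) eqP]; case: P' / eqP ps' => ps'.
  by move=> /num_inj/(inj_map code_path_inj)/val_inj->.
- move=> [/code_constraint_inj->//] v v' lt_v.
  have {lt_v} : code_set_var (@code_concept D) v < n.
    by apply: ltn_trans lt_v _; apply: lt leCn; rewrite !inE eqxx ?orbT.
  move=> /ltnW; case: v v' => [r|c|[P a]] [r'|c'|[P' a']] /= le_v /num_inj //.
  + by case=> ->.
  + by move=> [/IHn->//]; apply: lt le_v; rewrite !inE eqxx ?orbT.
  + move=> [/(pcan_inj pickleK) eqP]; case: P' / eqP a' => a'.
    by move=> /num_inj/(inj_map code_feature_arg_inj)/val_inj->.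
Qed.

Lemma code_tbox_inj (D : concrete_domain) : injective (@code_tbox D).
Proof.
move=> T T' /num_inj/inj_map; apply=> -[C1 C2] [C1' C2'] /num_inj /=.
by case=> /code_concept_inj-> /code_concept_inj->.
Qed.

(** * Decidability, by register machines with unboundedly many registers *)

(* [INC r]: increment register r and go to the next instruction.
   [DEC r q]: if register r is 0, jump to instruction q; otherwise decrement it
   and go to the next instruction. *)
Inductive instr : Type :=
  | INC (r : nat)
  | DEC (r q : nat).

Definition program := seq instr.

(* program counter and register contents *)
Definition config : Type := nat * (nat -> nat).

Definition upd (m : nat -> nat) (r x : nat) : nat -> nat :=
  fun r' => if r' == r then x else m r'.

(* The machine halts when the program counter leaves the program; halted
   configurations are fixed points of [step]. *)
Definition step (p : program) (c : config) : config :=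
  let: (pc, m) := c in
  match onth p pc with
  | None => c
  | Some (INC r) => (pc.+1, upd m r (m r).+1)
  | Some (DEC r q) => if m r == 0 then (q, m) else (pc.+1, upd m r (m r).-1)
  end.

(* The input is in register 0, all other registers being 0, and the output is
   read in register 0. *)
Definition outputs (p : program) (x y : nat) : Prop :=
  exists n : nat, let c := iter n (step p) (0, upd (fun=> 0) 0 x) in
    size p <= c.1 /\ c.2 0 = y.

(* Nothing is required of [p] on numbers that are not codes of instances. *)
Definition decides (X : Type) (code : X -> nat) (Q : X -> Prop) (p : program) :
    Prop :=
  forall x : X, (Q x -> outputs p (code x) 1) /\ (~ Q x -> outputs p (code x) 0).

Definition decidable_problem (X : Type) (code : X -> nat) (Q : X -> Prop) :
    Prop :=
  exists p : program, decides code Q p.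

(* Main.v *)
Require Import Defs.
From mathcomp Require Import all_boot.
From mathcomp Require Import boolp.
From mathcomp Require classical_sets functions cardinality.

Set Implicit Arguments.
Unset Strict Implicit.
Unset Printing Implicit Defensive.

(* Feature values name the configurations of a register machine: the elements
   sharing a value of feature 0 form one configuration, register r being counted
   by the elements of that class with a given concept name, and feature 1 points
   to the next class.  Since equality is definable by phi_=, the feature roles
   phi_=(f0, ∂f0) and phi_=(f1, ∂f0) make the sizes of these sets in the
   present and in the next class comparable by numerical constraints; a further
   count that strictly decreases prevents infinite or cyclic runs, so that the
   TBox of a program with a given input is consistent iff the program halts.

   Only one concept inclusion depends on the input.  Given a program p deciding
   consistency, let Q map x to the code of the TBox with tail coded by x and
   input x, run p on it and halt iff the TBox is found inconsistent.  On the code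
   of its own TBox, Q halts iff it does not. *)

(** * Register machines *)

Definition exec (p : program) (c c' : config) : Prop :=
  exists n, iter n (step p) c = c'.

Lemma exec_refl p c : exec p c c.
Proof. by exists 0. Qed.

Lemma exec_trans p c1 c2 c3 : exec p c1 c2 -> exec p c2 c3 -> exec p c1 c3.
Proof. by move=> [n <-] [k <-]; exists (k + n); rewrite iterD. Qed.

Lemma exec_step p c c' : exec p (step p c) c' -> exec p c c'.
Proof. by move=> [n <-]; exists n.+1; rewrite iterSr. Qed.

Lemma step_halted p (c : config) : size p <= c.1 -> step p c = c.
Proof. by case: c => pc m /= le_p; rewrite onth_default. Qed.

Definition runs (p : program) (m m' : nat -> nat) : Prop :=
  exists2 pc, size p <= pc & exec p (0, m) (pc, m').

(* A jump out of the program, which halts it, becomes a jump to its end. *)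
Definition reloc_instr (off sz : nat) (i : instr) : instr :=
  if i is DEC r q then DEC r (off + minn q sz) else i.

Definition reloc (off : nat) (p : program) : program :=
  map (reloc_instr off (size p)) p.

Lemma size_reloc off p : size (reloc off p) = size p.
Proof. exact: size_map. Qed.

Lemma exec_reloc (pre p post : program) pc m pc' m' :
  exec p (pc, m) (pc', m') ->
  exec (pre ++ reloc (size pre) p ++ post)
       (size pre + minn pc (size p), m) (size pre + minn pc' (size p), m').
Proof.
move=> [n]; elim: n pc m => [|n IHn] pc m.
  by case=> -> ->; apply: exec_refl.
rewrite iterSr; have [le_p|] := boolP (size p <= pc);
  last rewrite -ltnNge => lt_p.
  by rewrite step_halted //; apply: IHn.
case E: (step p (pc, m)) => [pc1 m1] /IHn; apply: exec_trans.
exists 1; rewrite /= (minn_idPl (ltnW lt_p)) onth_cat ltnNge leq_addr /= addKn.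
rewrite onth_cat size_reloc lt_p onth_map /=.
move: E; rewrite /=; case Ei: (onth p pc) => [[r|r q]|] /=.
- by case=> <- <-; rewrite (minn_idPl lt_p) addnS.
- by case: (m r =P 0) => _ [<- <-] //; rewrite (minn_idPl lt_p) addnS.
- by have := onthTE p pc; rewrite Ei lt_p.
Qed.

Definition pseq (p q : program) : program := reloc 0 p ++ reloc (size p) q.

Lemma size_pseq p q : size (pseq p q) = size p + size q.
Proof. by rewrite size_cat !size_reloc. Qed.

Lemma exec_pseq p q m m1 pc m2 : runs p m m1 -> exec q (0, m1) (pc, m2) ->
  exec (pseq p q) (0, m) (size p + minn pc (size q), m2).
Proof.
move=> [pc1 le1 /(exec_reloc [::] (reloc (size p) q))].
rewrite /= min0n add0n (minn_idPr le1) => H1.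
move=> /(exec_reloc (reloc 0 p) [::]).
rewrite cats0 size_reloc min0n addn0; exact: exec_trans H1.
Qed.

Lemma runs_pseq p q m m1 m2 :
  runs p m m1 -> runs q m1 m2 -> runs (pseq p q) m m2.
Proof.
move=> H1 [pc le_q /(exec_pseq H1) H2]; rewrite (minn_idPr le_q) in H2.
by exists (size p + size q); rewrite // size_pseq.
Qed.

Definition halts (p : program) (x : nat) : Prop :=
  exists n, size p <= (iter n (step p) (0, upd (fun=> 0) 0 x)).1.

Lemma runs_halts p x m : runs p (upd (fun=> 0) 0 x) m -> halts p x.
Proof. by move=> [pc le_p [n En]]; exists n; rewrite En. Qed.

Lemma outputs_runs p x y :
  outputs p x y -> exists2 m, runs p (upd (fun=> 0) 0 x) m & m 0 = y.
Proof.
move=> [n /=]; case E: (iter _ _ _) => [pc m] /= [le_p <-].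
by exists m => //; exists pc => //; exists n.
Qed.

Lemma stuck_not_halts p x c : exec p (0, upd (fun=> 0) 0 x) c ->
  c.1 < size p -> step p c = c -> ~ halts p x.
Proof.
move=> [k Ek] lt_p fix_c [n le_p].
have: size p <= (iter (n + k) (step p) (0, upd (fun=> 0) 0 x)).1.
  by rewrite addnC iterD iter_fix // step_halted.
by rewrite iterD Ek iter_fix // leqNgt lt_p.
Qed.

Lemma runs_INC r m : runs [:: INC r] m (upd m r (m r).+1).
Proof. by exists 1 => //; exists 1. Qed.

(* Register 4 is kept at zero, so that [DEC 4 q] is an unconditional jump. *)
Definition loop (a : nat) (body : program) : program :=
  DEC a (size body + 2) :: reloc 1 body ++ [:: DEC 4 0].

Lemma size_loop a body : size (loop a body) = size body + 2.
Proof. by rewrite /= size_cat size_reloc -addnS. Qed.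

Lemma runs_loop0 a body m : m a = 0 -> runs (loop a body) m m.
Proof.
move=> a0; exists (size body + 2); first by rewrite size_loop.
by exists 1; rewrite /= a0.
Qed.

Lemma runs_loopS a body m m1 m2 : m a != 0 ->
  runs body (upd m a (m a).-1) m1 -> m1 4 = 0 -> runs (loop a body) m1 m2 ->
  runs (loop a body) m m2.
Proof.
move=> /negPf a_neq0 [pc le_pc H1] z0 [pc2 le2 H2]; exists pc2 => //.
apply: exec_step; rewrite /= a_neq0.
have := exec_reloc [:: DEC a (size body + 2)] [:: DEC 4 0] H1.
rewrite /= min0n addn0 (minn_idPr le_pc) => /exec_trans; apply.
apply: exec_step; rewrite add1n /= onth_cat size_reloc ltnn subnn /= z0 /=.
exact: H2.
Qed.

Lemma upd_id m r x : m r = x -> upd m r x = m.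
Proof. by move=> <-; apply/funext => s; rewrite /upd; case: eqP => // ->. Qed.

Lemma runs_INCs bs m :
  runs (map INC bs) m (fun r => m r + count_mem r bs).
Proof.
elim: bs m => [|b bs IHbs] m.
  exists 0 => //; exists 0; congr (_, _).
  by apply/funext => r /=; rewrite addn0.
have := runs_pseq (runs_INC b m) (IHbs _).
rewrite /pseq /= [reloc _ _](_ : _ = map INC bs);
  last by rewrite /reloc -map_comp.
congr (runs _ _); apply/funext => r; rewrite /upd /= eq_sym.
by case: eqP => [->|_]; rewrite ?add0n // addSnnS.
Qed.

Definition add_to (a : nat) (bs : seq nat) : program := loop a (map INC bs).

Definition added (a : nat) (bs : seq nat) (m : nat -> nat) : nat -> nat :=
  fun r => if r == a then 0 else m r + m a * count_mem r bs.

Lemma runs_add_to a bs m : a != 4 -> a \notin bs -> 4 \notin bs -> m 4 = 0 ->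
  runs (add_to a bs) m (added a bs m).
Proof.
rewrite /added => a4 abs zbs; move Ek: (m a) => k; elim: k m Ek => [|k IHk] m Ek z0.
  rewrite [X in runs _ _ X](_ : _ = m); first exact: runs_loop0.
  by apply/funext => r; case: eqP => [->//|_]; rewrite addn0.
apply: runs_loopS (runs_INCs _ _) _ _; rewrite Ek //.
  by rewrite /upd eq_sym (negPf a4) z0 (count_memPn zbs).
set m1 := fun r => _.
have m1a : m1 a = k by rewrite /m1 /upd eqxx (count_memPn abs) addn0.
have := IHk m1 m1a; rewrite /m1 /upd (eq_sym 4) (negPf a4) z0 (count_memPn zbs).
move=> /(_ erefl); congr (runs _ _); apply/funext => r.
by case: eqP => // _; rewrite mulSn addnA.
Qed.

Definition double_reg (b : nat) : program :=
  pseq (add_to b [:: 3; 3]) (add_to 3 [:: b]).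

Lemma runs_double_reg b m : b != 3 -> b != 4 -> m 3 = 0 -> m 4 = 0 ->
  runs (double_reg b) m (upd m b (m b).*2).
Proof.
move=> b3 b4 m3 m4; apply: runs_pseq.
  by apply: runs_add_to; rewrite // !inE negb_or ?b3.
set m1 := added _ _ _.
have z0 : m1 4 = 0 by rewrite /m1 /added eq_sym (negPf b4) m4 muln0.
have -> : upd m b (m b).*2 = added 3 [:: b] m1.
  apply/funext => r; rewrite /m1 /added /upd /= !addn0.
  rewrite (eq_sym 3 b) (negPf b3) m3 add0n muln2 (eq_sym b r).
  case: (r =P b) => [->|_]; first by rewrite (negPf b3) add0n muln1.
  case: (r =P 3) => [->//|/eqP r3].
  by rewrite eq_sym (negPf r3) !muln0 !addn0.
by apply: runs_add_to; rewrite // ?inE eq_sym.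
Qed.

Definition shift_reg (b : nat) : program := loop 0 (double_reg b).

Lemma runs_shift_reg b m : b != 0 -> b != 3 -> b != 4 -> m 3 = 0 -> m 4 = 0 ->
  runs (shift_reg b) m (upd (upd m b (2 ^ m 0 * m b)) 0 0).
Proof.
move=> b0 b3 b4; move Ek: (m 0) => k; elim: k m Ek => [|k IHk] m Ek m3 m4.
  by rewrite mul1n upd_id // upd_id //; apply: runs_loop0.
apply: runs_loopS (runs_double_reg _ _ _ _) _ _; rewrite ?Ek //.
  by rewrite /upd eq_sym (negPf b4).
set m1 := upd _ b _.
have := IHk m1; rewrite /m1 /upd ![_ == b]eq_sym.
rewrite (negPf b0) (negPf b3) (negPf b4).
move=> /(_ erefl m3 m4); congr (runs _ _); apply/funext => r.
by case: (r == 0); case: (r == b); rewrite ?eqxx // expnSr -mulnA mul2n.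
Qed.

(* Registers 2, 3 and 4 are scratch; register 1 must survive. *)
Definition computable (f : nat -> nat) : Prop :=
  exists p, forall m, m 2 = 0 -> m 3 = 0 -> m 4 = 0 ->
    runs p m (upd m 0 (f (m 0))).

Lemma computable_comp f g : computable f -> computable g -> computable (f \o g).
Proof.
move=> [p Hp] [q Hq]; exists (pseq q p) => m m2 m3 m4.
apply: runs_pseq (Hq _ m2 m3 m4) _.
have := Hp (upd m 0 (g (m 0))) m2 m3 m4.
by congr (runs _ _); apply/funext => r; rewrite /upd /=; case: eqP.
Qed.

Lemma computable_succ : computable succn.
Proof. by exists [:: INC 0] => m _ _ _; apply: runs_INC. Qed.

Lemma computable_double : computable double.
Proof. by exists (double_reg 0) => m _ m3 m4; apply: runs_double_reg. Qed.

Lemma computable_iter k f : computable f -> computable (iter k f).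
Proof.
move=> f_comp; elim: k => [|k IHk]; last exact: (computable_comp f_comp IHk).
by exists [::] => m _ _ _; rewrite upd_id //; exists 0 => //; exists 0.
Qed.

Lemma computable_exp2 : computable (expn 2).
Proof.
exists (pseq [:: INC 2] (pseq (shift_reg 2) (add_to 2 [:: 0]))) => m m2 m3 m4.
apply: runs_pseq (runs_INC _ _) (runs_pseq (runs_shift_reg _ _ _ _ _) _) => //.
set m1 := upd _ 0 0; have := @runs_add_to 2 [:: 0] m1 erefl erefl erefl m4.
congr (runs _ _); apply/funext; rewrite /m1 /added /upd.
by do 3?[case=> //=] => *; rewrite ?m2 ?muln0 ?muln1 ?add0n ?addn0.
Qed.

Lemma computable_code_cons k : computable (fun x => 2 ^ k * x.*2.+1).
Proof.
have -> : (fun x => 2 ^ k * x.*2.+1) = iter k double \o (succn \o double).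
  apply/funext => x /=; elim: k => [|k IHk] /=; first by rewrite mul1n.
  by rewrite -IHk expnS -mulnA mul2n.
apply: computable_comp (computable_iter k computable_double) _.
exact: computable_comp computable_succ computable_double.
Qed.

Lemma pair_program f : computable f -> exists p, forall x,
  runs p (upd (fun=> 0) 0 x) (upd (fun=> 0) 0 (2 ^ f x * x.*2.+1)).
Proof.
move=> [p Hp].
exists (pseq (add_to 0 [:: 1; 2]) (pseq (add_to 2 [:: 0]) (pseq p
  (pseq (double_reg 1) (pseq [:: INC 1] (pseq (shift_reg 1)
    (add_to 1 [:: 0]))))))) => x.
pose s := upd (upd (fun=> 0) 0 x) 1 x.
apply: runs_pseq (runs_add_to _ _ _ _) _ => //.
set m1 := added _ _ _.
apply: (@runs_pseq _ _ _ s).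
  have m14 : m1 4 = 0 by rewrite /m1 /added /= muln0.
  have := @runs_add_to 2 [:: 0] m1 erefl erefl erefl m14.
  congr (runs _ _); apply/funext; rewrite /m1 /added /s /upd.
  by do 3?[case=> //=] => *; rewrite ?muln0 ?muln1 ?add0n ?addn0.
apply: runs_pseq (Hp _ _ _ _) _ => //.
apply: runs_pseq (runs_double_reg _ _ _ _) _ => //.
apply: runs_pseq (runs_INC _ _) _.
apply: runs_pseq (runs_shift_reg _ _ _ _ _) _ => //.
set m2 := upd _ 0 0.
have := @runs_add_to 1 [:: 0] m2 erefl erefl erefl erefl.
congr (runs _ _); apply/funext; rewrite /m2 /added /s /upd.
by do 3?[case=> //=] => *; rewrite ?muln0 ?muln1 ?add0n ?addn0.
Qed.

(* On 1, control stays forever at the second instruction, a jump to itself. *)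
Definition flip : program := [:: DEC 0 2; DEC 0 1].

Lemma halts_pseq_flip p x m : runs p (upd (fun=> 0) 0 x) m -> m 0 = 0 ->
  halts (pseq p flip) x.
Proof.
move=> Hp m0; apply: runs_halts (runs_pseq Hp _).
by exists 2 => //; exists 1; rewrite /= m0.
Qed.

Lemma not_halts_pseq_flip p x m : runs p (upd (fun=> 0) 0 x) m -> m 0 = 1 ->
  ~ halts (pseq p flip) x.
Proof.
move=> Hp m0.
have H1 : exec flip (0, m) (1, upd m 0 0) by exists 1; rewrite /= m0.
have := exec_pseq Hp H1; rewrite (minn_idPl _) // => /stuck_not_halts; apply.
  by rewrite size_pseq /= ltn_add2l.
rewrite /= /pseq onth_cat size_reloc ltnNge leq_addr /= addKn /=.
by rewrite (minn_idPl _).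
Qed.

(** * Definable equality as a set constraint *)

Definition pair_env (T : Type) (x y : T) (v : bool) : T := if v then y else x.

Section Equality.
Variable D : concrete_domain.
Local Notation set_expr := (set_term (set_var D (concept D))).

Fixpoint qf_set (al : bool -> feature_arg) (phi : qf_formula D bool) :
    set_expr :=
  match phi with
  | QFAtom _ vs => SVar (VFRole _ (FRole (map_tuple al vs)))
  | QFNot phi => SCompl (qf_set al phi)
  | QFAnd phi psi => SInter (qf_set al phi) (qf_set al psi)
  | QFOr phi psi => SUnion (qf_set al phi) (qf_set al psi)
  end.

(* An undefined feature falsifies every atom that mentions it, so a true atom
   containing x certifies that the feature substituted for x is defined. *)
Fixpoint touched (env : bool -> D) (phi : qf_formula D bool) : Prop :=
  match phi with
  | QFAtom _ vs => false \in (vs : seq bool) /\ pred_interp (map_tuple env vs)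
  | QFNot phi => touched env phi
  | QFAnd phi psi | QFOr phi psi => touched env phi \/ touched env psi
  end.

Fixpoint touched_set (al : bool -> feature_arg) (phi : qf_formula D bool) :
    set_expr :=
  match phi with
  | QFAtom _ vs => if false \in (vs : seq bool)
      then SVar (VFRole _ (FRole (map_tuple al vs))) else SEmpty
  | QFNot phi => touched_set al phi
  | QFAnd phi psi | QFOr phi psi =>
      SUnion (touched_set al phi) (touched_set al psi)
  end.

Lemma untouched_eq_holds x x' y phi :
  ~ touched (pair_env x y) phi -> ~ touched (pair_env x' y) phi ->
  qf_holds (pair_env x y) phi <-> qf_holds (pair_env x' y) phi.
Proof.
elim: phi => [P vs|phi IH|phi IH psi IH'|phi IH psi IH'] /=.
- have [vs_x|vs_x] := boolP (false \in (vs : seq bool)).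
    by move=> n1 n2; split=> H; [case: n1|case: n2].
  move=> _ _.
  suff -> : map_tuple (pair_env x y) vs = map_tuple (pair_env x' y) vs by [].
  by apply/val_inj/eq_in_map => -[] // /idPn; rewrite vs_x.
- by move=> n1 n2; rewrite (IH n1 n2).
- by move=> /not_orP[n1 n1'] /not_orP[n2 n2']; rewrite (IH n1 n2) (IH' n1' n2').
- by move=> /not_orP[n1 n1'] /not_orP[n2 n2']; rewrite (IH n1 n2) (IH' n1' n2').
Qed.

Variable I : interpretation D.

Definition set_at (d : I) (s : set_expr) : {set I} :=
  set_value (set_var_value (@concept_ext D I) d) s.

Lemma mem_set_at_frole (d e : I) al env (P : predicate D)
    (vs : (arity P).-tuple bool) :
  (forall v, feature_arg_value d e (al v) = Some (env v)) ->
  e \in set_at d (SVar (VFRole _ (FRole (map_tuple al vs)))) <->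
  pred_interp (map_tuple env vs).
Proof.
move=> al_env; rewrite inE; split=> [/asboolP[c c_al]|env_vs].
  suff -> : c = map_tuple env vs by [].
  apply: eq_from_tnth => i; have := c_al i.
  by rewrite !tnth_map al_env => -[->].
by apply/asboolP; exists (map_tuple env vs) => // i; rewrite !tnth_map.
Qed.

Lemma mem_qf_set (d e : I) al env phi :
  (forall v, feature_arg_value d e (al v) = Some (env v)) ->
  e \in set_at d (qf_set al phi) <-> qf_holds env phi.
Proof.
move=> al_env; elim: phi => [P vs|phi IH|phi IH psi IH'|phi IH psi IH'].
- exact: mem_set_at_frole.
- by rewrite /set_at inE /= -IH; split=> /negP.
- by rewrite /set_at inE /= -IH -IH'; split=> /andP.
- by rewrite /set_at inE /= -IH -IH'; split=> /orP.
Qed.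

Lemma mem_touched_set (d e : I) al env phi :
  (forall v, feature_arg_value d e (al v) = Some (env v)) ->
  touched env phi -> e \in set_at d (touched_set al phi).
Proof.
move=> al_env; elim: phi => [P vs|//|phi IH psi IH'|phi IH psi IH'] /=.
- by case=> -> /(mem_set_at_frole _ al_env).
- by rewrite /set_at inE => -[/IH|/IH'] /= ->; rewrite ?orbT.
- by rewrite /set_at inE => -[/IH|/IH'] /= ->; rewrite ?orbT.
Qed.

Lemma touched_set_defined (d e : I) al phi :
  e \in set_at d (touched_set al phi) ->
  exists x, feature_arg_value d e (al false) = Some x.
Proof.
elim: phi => [P vs|//|phi IH psi IH'|phi IH psi IH'] /=.
- case: ifP => [/tnthP[i vs_i]|_]; last by rewrite inE.
  rewrite inE => /asboolP[c /(_ i)]; rewrite tnth_map -vs_i => -> _.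
  by exists (tnth c i).
- by rewrite /set_at inE => /orP[/IH|/IH'].
- by rewrite /set_at inE => /orP[/IH|/IH'].
Qed.

End Equality.

Lemma infinite_injection (D : concrete_domain) : infinite_domain D ->
  exists a : nat -> D, injective a.
Proof.
move=> /cardinality.infiniteP/cardinality.card_leP.
move=> /cardinality.injfunPex[f _ f_inj].
exists (fun n => \val (f (functions.to_setT n))) => n k.
by move=> /val_inj/f_inj; rewrite !classical_sets.in_setT => /(_ isT isT) [].
Qed.

(* At most one value of x leaves all atoms containing x false, whatever y. *)
Lemma touched_injection (D : concrete_domain) (phi : qf_formula D bool) :
  infinite_domain D ->
  (forall x y : D, qf_holds (pair_env x y) phi <-> x = y) ->
  exists a w : nat -> D, injective a /\
    forall n, touched (pair_env (a n) (w n)) phi.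
Proof.
move=> D_inf phi_eq.
have [a a_inj] := infinite_injection D_inf.
pose null n := forall y, ~ touched (pair_env (a n) y) phi.
have null_uniq n k : null n -> null k -> n = k.
  move=> null_n null_k; apply/a_inj/phi_eq.
  by rewrite (untouched_eq_holds (null_n _) (null_k _)); apply/phi_eq.
have [b b_ok] : exists b, forall n, ~ null (b + n).
  have [[k null_k]|no_null] := EM (exists k, null k).
    exists k.+1 => n /null_uniq/(_ null_k)/eqP.
    by rewrite addSnnS -{2}[k]addn0 eqn_add2l.
  by exists 0 => n null_n; apply: no_null; exists n.
have /choice[w Hw] n : exists y, touched (pair_env (a (b + n)) y) phi.
  by have /existsNP[y /contrapT] := b_ok n; exists y.
by exists (fun n => a (b + n)), w; split=> // n k /a_inj/addnI.
Qed.

(** * Machine runs as models *)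

Local Notation num := CodeSeq.code.

Lemma all_flatten (T : Type) (P : pred T) (ss : seq (seq T)) :
  all P (flatten ss) = all (all P) ss.
Proof. by elim: ss => //= s ss IHss; rewrite all_cat IHss. Qed.

Definition instr_reg (i : instr) : nat :=
  match i with INC r => r | DEC r _ => r end.

Definition exec_instr (i : instr) (c : config) : config :=
  let: (pc, m) := c in
  match i with
  | INC r => (pc.+1, upd m r (m r).+1)
  | DEC r q => if m r == 0 then (q, m) else (pc.+1, upd m r (m r).-1)
  end.

Lemma step_onth p i c : onth p c.1 = Some i -> step p c = exec_instr i c.
Proof. by case: c => pc m /= ->; case: i. Qed.

Definition reg_bound (p : program) : nat :=
  foldr (fun i n => maxn (instr_reg i).+1 n) 0 p.

Lemma ltn_reg_bound p pc i : onth p pc = Some i -> instr_reg i < reg_bound p.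
Proof.
elim: p pc => [|j p IHp] [|pc] //=; first by case=> ->; rewrite leq_maxl.
by move=> /IHp lt_i; rewrite leq_max lt_i orbT.
Qed.

(* A configuration of the machine is encoded by a class of elements agreeing on
   feature 0, which holds the class identifier; feature 1 holds the identifier
   of the next class, and features 2 and 3 witness that features 0 and 1 are
   defined.  Register r is the number of elements of [reg_name r] in the class,
   and the number of elements of [clock_name] decreases at each step. *)
Definition start_name : nat := 0.
Definition clock_name : nat := 2.
Definition state_name (i : nat) : nat := i.*2.+1.
Definition reg_name (r : nat) : nat := r.+2.*2.

Section Encoding.
Variables (D : concrete_domain) (phi : qf_formula D bool).
Local Notation set_expr := (set_term (set_var D (concept D))).

Definition same_class : set_expr := qf_set (pair_env (Here 0) (There 0)) phi.
Definition next_class : set_expr := qf_set (pair_env (Here 1) (There 0)) phi.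

Definition inter_name (s : set_expr) (A : nat) : set_expr :=
  SInter s (SVar (VConcept D (CName D A))).

Definition count_plus (s : set_expr) (A k : nat) :
    pa_expr (set_var D (concept D)) :=
  PAAdd 1 (inter_name s A) (PAConst k).

Definition top_concept : concept D := CSat (CSub SEmpty SEmpty).

Definition nonempty_concept (s : set_expr) : concept D :=
  CNot (CSat (CSub s SEmpty)).

Definition zero_concept (r : nat) : concept D :=
  CSat (CEqN (count_plus same_class (reg_name r) 0) (PAConst 0)).

Definition defined_concept (f w : nat) : concept D :=
  nonempty_concept (touched_set (pair_env (Here f) (Here w)) phi).

(* The next class is in state [q], and its register [r] differs from that of the
   present class by [k - l]. *)
Definition transition (N : nat) (G : concept D) (q r k l : nat) : tbox D :=
  [:: (G, CSat (CLtN (count_plus next_class clock_name 0)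
                     (count_plus same_class clock_name 0)));
      (G, nonempty_concept (inter_name next_class (state_name q)))] ++
  [seq (G, CSat (CEqN
      (count_plus next_class (reg_name s) (if s == r then l else 0))
      (count_plus same_class (reg_name s) (if s == r then k else 0))))
    | s <- iota 0 N].

Definition instr_tbox (N pc : nat) (i : instr) : tbox D :=
  match i with
  | INC r => transition N (CName D (state_name pc)) pc.+1 r 1 0
  | DEC r q =>
      transition N (CAnd (CName D (state_name pc)) (zero_concept r)) q r 0 0 ++
      transition N (CAnd (CName D (state_name pc)) (CNot (zero_concept r)))
        pc.+1 r 0 1
  end.

Definition base_tbox (N : nat) : tbox D :=
  [:: (top_concept, defined_concept 0 2);
      (top_concept, defined_concept 1 3);
      (top_concept, nonempty_concept (SVar (VConcept D (CName D start_name))));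
      (CName D start_name, CName D (state_name 0))] ++
  [seq (CName D start_name, zero_concept s) | s <- iota 1 N].

Definition program_tbox (p : program) : tbox D :=
  base_tbox (reg_bound p) ++
  flatten [seq
      if onth p pc is Some i then instr_tbox (reg_bound p) pc i else [::]
    | pc <- iota 0 (size p)].

Definition input_ci (x : nat) : concept D * concept D :=
  (CName D start_name,
   CSat (CEqN (count_plus same_class (reg_name 0) 0) (PAConst x))).

Hypothesis phi_eq : forall x y : D, qf_holds (pair_env x y) phi <-> x = y.

Section Model.
Variable I : interpretation D.

Definition obeys (d : I) (T : tbox D) : bool :=
  all (fun ci => (d \in concept_ext I ci.1) ==> (d \in concept_ext I ci.2)) T.

Lemma is_modelP T : is_model I T <-> forall d, obeys d T.
Proof.
elim: T => [|ci T IHT] //=; rewrite /obeys /=; split.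
  move=> /andP[/subsetP sub /IHT T_model] d.
  by apply/andP; split; [apply/implyP/sub|apply: T_model].
move=> ciT_model; apply/andP; split;
  last by apply/IHT => d; case/andP: (ciT_model d).
by apply/subsetP => d; apply/implyP; case/andP: (ciT_model d).
Qed.

Definition count_at (d : I) (s : set_expr) (A : nat) : nat :=
  #|set_at d s :&: concept_interp I A|.

Lemma mem_nonempty (d : I) s :
  (d \in concept_ext I (nonempty_concept s)) = (set_at d s != set0).
Proof. by rewrite !inE /= subset0. Qed.

Lemma mem_zero (d : I) r :
  (d \in concept_ext I (zero_concept r)) =
  (count_at d same_class (reg_name r) == 0).
Proof. by rewrite inE /= mul1n addn0. Qed.

Lemma mem_input (d : I) x : (d \in concept_ext I (input_ci x).2) =
  (count_at d same_class (reg_name 0) == x).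
Proof. by rewrite inE /= mul1n addn0. Qed.

Lemma obeys_transition (d : I) N G q r k l :
  obeys d (transition N G q r k l) =
  (d \in concept_ext I G) ==>
  [&& count_at d next_class clock_name < count_at d same_class clock_name,
      set_at d next_class :&: concept_interp I (state_name q) != set0 &
      all (fun s =>
          count_at d next_class (reg_name s) + (if s == r then l else 0) ==
          count_at d same_class (reg_name s) + (if s == r then k else 0))
        (iota 0 N)].
Proof.
rewrite /transition /obeys all_cat all_map /= !inE subset0 !mul1n !addn0.
have [dG|/negPf dG] := boolP (d \in concept_ext I G); last first.
  by apply/allP => s _ /=; rewrite dG.
rewrite [_ && true]andbT -andbA; congr [&& _, _ & _]; apply: eq_all => s /=.
by rewrite dG inE /= !mul1n.
Qed.

Lemma obeys_instr (d : I) N pc i m : d \in concept_interp I (state_name pc) ->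
  instr_reg i < N ->
  (forall r, r < N -> count_at d same_class (reg_name r) = m r) ->
  let c := exec_instr i (pc, m) in
  obeys d (instr_tbox N pc i) <->
  [/\ count_at d next_class clock_name < count_at d same_class clock_name,
      set_at d next_class :&: concept_interp I (state_name c.1) != set0 &
      forall r, r < N -> count_at d next_class (reg_name r) = c.2 r].
Proof.
move=> d_pc; case: i => [r|r q] lt_r same_m c; rewrite /instr_tbox {}/c.
  rewrite obeys_transition [d \in _]d_pc /=.
  split=> [/and3P[? ? /allP next_eq]|[-> -> next_m]].
    split=> // s lt_s; have := next_eq s; rewrite mem_iota => /(_ lt_s)/eqP.
    rewrite if_same addn0 same_m // => ->.
    by rewrite /upd; case: (s =P r) => [->|_]; rewrite ?addn0 // addn1.
  apply/allP => s; rewrite mem_iota add0n => lt_s; rewrite if_same addn0.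
  rewrite next_m // same_m // /upd.
  by case: (s =P r) => [->|_]; rewrite ?addn0 // addn1.
rewrite /obeys all_cat -!/(obeys _ _) !obeys_transition.
have mem_and C : (d \in concept_ext I (CAnd (CName D (state_name pc)) C)) =
    (d \in concept_ext I C) by rewrite inE [d \in _]d_pc.
have mem_not C : (d \in concept_ext I (CNot C)) = (d \notin concept_ext I C).
  by rewrite inE.
rewrite !mem_and mem_not mem_zero same_m //=.
case: (m r =P 0) => [_|/eqP mr] /=; rewrite ?andbT.
  split=> [/and3P[? ? /allP next_eq]|[-> -> next_m]].
    split=> // s lt_s; have := next_eq s; rewrite mem_iota => /(_ lt_s)/eqP.
    by rewrite same_m // !if_same !addn0.
  apply/allP => s; rewrite mem_iota add0n => lt_s.
  by rewrite next_m // same_m.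
split=> [/and3P[? ? /allP next_eq]|[-> -> next_m]].
  split=> // s lt_s; have := next_eq s; rewrite mem_iota => /(_ lt_s)/eqP.
  rewrite if_same addn0 same_m // /upd.
  by case: (s =P r) => [-> <-|_]; rewrite ?addn0 ?addn1.
apply/allP => s; rewrite mem_iota add0n => lt_s.
rewrite next_m // same_m // if_same addn0 /upd.
by case: (s =P r) => [->|_]; rewrite ?addn0 // addn1 prednK // lt0n.
Qed.

Lemma obeys_base (d : I) N : obeys d (base_tbox N) <->
  [/\ d \in concept_ext I (defined_concept 0 2),
      d \in concept_ext I (defined_concept 1 3),
      concept_interp I start_name != set0 &
      d \in concept_interp I start_name ->
      d \in concept_interp I (state_name 0) /\
      forall r, 0 < r <= N -> count_at d same_class (reg_name r) = 0].
Proof.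
have d_top : d \in concept_ext I top_concept by rewrite inE /= subxx.
rewrite /obeys all_cat; split.
  move=> /andP[/and5P[/implyP/(_ d_top) def0 /implyP/(_ d_top) def1]].
  move=> /implyP/(_ d_top); rewrite mem_nonempty => start_d /implyP d0 _.
  rewrite all_map => /allP zero_d; split=> // d_start.
  split=> [|r r_N]; first exact: d0.
  have := zero_d r; rewrite mem_iota add1n ltnS => /(_ r_N) /=.
  by rewrite [d \in _]d_start mem_zero => /eqP.
move=> [def0 def1 start_d d0]; apply/andP; split.
  apply/and5P; split=> //; apply/implyP => //; last by case/d0.
  by rewrite mem_nonempty.
rewrite all_map; apply/allP => r; rewrite mem_iota add1n ltnS => r_N.
by apply/implyP => /d0[_ /(_ r r_N) zero_r]; rewrite mem_zero zero_r.
Qed.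

Lemma obeys_instr_off (d : I) N pc i :
  d \notin concept_interp I (state_name pc) ->
  obeys d (instr_tbox N pc i).
Proof.
move=> /negPf d_pc; have mem_and C :
    (d \in concept_ext I (CAnd (CName D (state_name pc)) C)) = false.
  by rewrite inE [d \in _]d_pc.
case: i => [r|r q]; first by rewrite obeys_transition [d \in _]d_pc.
by rewrite /obeys all_cat -!/(obeys _ _) !obeys_transition !mem_and.
Qed.

Lemma mem_defined (d : I) f g x y :
  feature_interp f d = Some x -> feature_interp g d = Some y ->
  touched (pair_env x y) phi -> d \in concept_ext I (defined_concept f g).
Proof.
move=> fx gy xy; rewrite mem_nonempty; apply/set0Pn; exists d.
by apply: mem_touched_set xy => -[].
Qed.

Lemma defined_feature (d : I) f g : d \in concept_ext I (defined_concept f g) ->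
  exists x, feature_interp f d = Some x.
Proof. by rewrite mem_nonempty => /set0Pn[e /touched_set_defined]. Qed.

Lemma mem_class (d e : I) (f : nat) x y :
  feature_interp f d = Some x -> feature_interp 0 e = Some y ->
  e \in set_at d (qf_set (pair_env (Here f) (There 0)) phi) <-> x = y.
Proof.
move=> fx fy.
by rewrite (@mem_qf_set _ _ d e _ (pair_env x y)) ?phi_eq // => -[].
Qed.

Lemma next_class_same (d e : I) :
  (forall d : I, exists x, feature_interp 0 d = Some x) ->
  (exists x, feature_interp 1 d = Some x) ->
  e \in set_at d next_class -> set_at d next_class = set_at e same_class.
Proof.
move=> def0 [x dx]; have [y ey] := def0 e => /(mem_class dx ey) xy.
apply/setP => e'; have [y' e'y'] := def0 e'; apply/idP/idP.
  by move=> /(mem_class dx e'y') xy'; apply/(mem_class ey e'y'); rewrite -xy.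
by move=> /(mem_class ey e'y') yy'; apply/(mem_class dx e'y'); rewrite xy.
Qed.

Lemma obeys_program (d : I) p x : obeys d (input_ci x :: program_tbox p) <->
  [/\ obeys d [:: input_ci x], obeys d (base_tbox (reg_bound p)) &
      forall pc i, onth p pc = Some i ->
        obeys d (instr_tbox (reg_bound p) pc i)].
Proof.
rewrite -cat1s /obeys all_cat /program_tbox all_cat all_flatten all_map.
split=> [/and3P[-> -> /allP p_obeys]|[-> -> p_obeys]].
  split=> // pc i pc_i; have := p_obeys pc; rewrite mem_iota /= pc_i; apply.
  by rewrite add0n -onthTE pc_i.
by apply/allP => pc _ /=; case E: (onth p pc) => [i|] //; apply: p_obeys.
Qed.

Lemma model_halts p x : is_model I (input_ci x :: program_tbox p) -> halts p x.
Proof.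
rewrite is_modelP => I_obeys; set N := reg_bound p in I_obeys.
have obeys_base_d d : obeys d (base_tbox N).
  by have /obeys_program[] := I_obeys d.
have obeys_pc d pc i : onth p pc = Some i -> obeys d (instr_tbox N pc i).
  by have /obeys_program[_ _] := I_obeys d; apply.
have def0 (d : I) : exists y, feature_interp 0 d = Some y.
  by have [/defined_feature] := (obeys_base _ _).1 (obeys_base_d d).
have def1 (d : I) : exists y, feature_interp 1 d = Some y.
  by have [_ /defined_feature] := (obeys_base _ _).1 (obeys_base_d d).
have run k (d : I) pc m : count_at d same_class clock_name < k ->
    d \in concept_interp I (state_name pc) ->
    (forall r, r < N -> count_at d same_class (reg_name r) = m r) ->
    exists n, size p <= (iter n (step p) (pc, m)).1.
  elim: k d pc m => // k IHk d pc m clk d_pc d_m.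
  case pc_i: (onth p pc) => [i|];
    last by exists 0; rewrite /= leqNgt -onthTE pc_i.
  have /(obeys_instr d_pc (ltn_reg_bound pc_i) d_m) := obeys_pc d _ _ pc_i.
  rewrite -(step_onth (c := (pc, m)) pc_i).
  case Est: (step p (pc, m)) => [pc' m'] [clk' /set0Pn[e]].
  rewrite inE => /andP[e_next e_pc'] e_m'; move: clk' e_m'.
  rewrite /count_at (next_class_same def0 (def1 d) e_next) => clk' e_m'.
  have [|n n_halt] := IHk e pc' m' _ e_pc' e_m';
    first exact: leq_trans clk' clk.
  by exists n.+1; rewrite iterSr Est.
have [d0 _] := card_gt0P (delta_nonempty I).
have [_ _ /set0Pn[d d_start] _] := (obeys_base _ _).1 (obeys_base_d d0).
have [_ _ _ /(_ d_start)[d_pc d_m]] := (obeys_base _ _).1 (obeys_base_d d).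
apply: run (ltnSn _) d_pc _ => -[|r] lt_r; last by apply/d_m/ltnW.
have /andP[/implyP/(_ d_start)] := I_obeys d.
by rewrite mem_input => /eqP.
Qed.

End Model.

Lemma iter_step_leq p x t r :
  (iter t (step p) (0, upd (fun=> 0) 0 x)).2 r <= x + t.
Proof.
elim: t r => [|t IHt] r.
  by rewrite /upd /=; case: eqP => //; rewrite addn0.
rewrite iterS addnS; case: (iter t _ _) IHt => pc m /= m_le.
case: (onth p pc) => [[s|s q]|] /=; last by rewrite ltnW // ltnS.
  by rewrite /upd; case: eqP => _; rewrite ?ltnS // ltnW // ltnS.
case: (m s == 0) => /=; rewrite ltnW // ltnS // /upd.
by case: eqP => // _; apply: leq_trans (leq_pred _) _.
Qed.

Lemma card_slice n b (t : 'I_n) v : v <= b ->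
  #|[set e : 'I_n * 'I_b | (e.1 == t) && (e.2 < v)]| = v.
Proof.
move=> le_v; have -> : [set e : 'I_n * 'I_b | (e.1 == t) && (e.2 < v)] =
    [set (t, widen_ord le_v j) | j : 'I_v].
  apply/setP => -[s j]; rewrite inE /=.
  apply/andP/imsetP => [[/eqP-> lt_j]|[i _ [-> ->]]].
    by exists (Ordinal lt_j) => //; congr (_, _); apply/val_inj.
  by rewrite eqxx /= ltn_ord.
by rewrite card_imset ?card_ord // => i j [/val_inj].
Qed.

Section RunModel.
Variables (p : program) (x n : nat) (a w : nat -> D).
Hypotheses (a_inj : injective a).
Hypothesis aw_touched : forall k, touched (pair_env (a k) (w k)) phi.
Hypothesis halted : size p <= (iter n (step p) (0, upd (fun=> 0) 0 x)).1.

Let conf t := iter t (step p) (0, upd (fun=> 0) 0 x).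

(* The elements (t, j) form the class of the configuration at time t, and (t, j)
   counts in register r iff j is less than the contents of r at time t. *)
Definition run_concept (A : nat) : {set 'I_n.+1 * 'I_(x + n).+1} :=
  [set e : 'I_n.+1 * 'I_(x + n).+1 |
     if A == start_name then e.1 == ord0
     else if odd A then (conf e.1).1 == A./2
     else e.2 < if A == clock_name then n - e.1 else (conf e.1).2 (A./2).-2].

Definition run_feature (f : nat) (e : 'I_n.+1 * 'I_(x + n).+1) : option D :=
  Some (nth w [:: a; a \o succn; w; w \o succn] f e.1).

Lemma run_nonempty : 0 < #|{: 'I_n.+1 * 'I_(x + n).+1}|.
Proof. by rewrite card_prod !card_ord. Qed.

Definition run_interp : interpretation D :=
  Interpretation run_nonempty run_concept (fun=> set0) run_feature.

Lemma run_count (d : run_interp) f (t : 'I_n.+1) :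
  nth w [:: a; a \o succn; w; w \o succn] f d.1 = a t ->
  let S := qf_set (pair_env (Here f) (There 0)) phi in
  count_at d S clock_name = n - t /\
  forall r, count_at d S (reg_name r) = (conf t).2 r.
Proof.
move=> d_t S; have in_S e : (e \in set_at d S) = (e.1 == t).
  apply/idP/eqP => [/(mem_class (x := a t) (y := a e.1))|e_t].
    by rewrite /= /run_feature d_t => /(_ erefl erefl)/a_inj/val_inj.
  apply/(mem_class (x := a t) (y := a e.1)) => //=.
    by rewrite /run_feature d_t.
  by rewrite e_t.
have count A v : (forall e : run_interp, e.1 = t ->
      (e \in concept_interp run_interp A) = (e.2 < v)) ->
    v <= (x + n).+1 -> count_at d S A = v.
  move=> A_v le_v; rewrite -[RHS](card_slice t le_v); apply: eq_card => e.
  by rewrite in_setI in_S [RHS]inE; case: eqP => //= /A_v ->.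
split=> [|r]; apply: count.
- by move=> e <-; rewrite inE.
- by rewrite (leq_trans (leq_subr _ _)) // ltnW // ltnS leq_addl.
- by move=> e <-; rewrite inE /= odd_double /= doubleK.
- rewrite (leq_trans (iter_step_leq _ _ _ _)) // ltnW // ltnS leq_add2l.
  by rewrite -ltnS.
Qed.

Lemma run_is_model : is_model run_interp (input_ci x :: program_tbox p).
Proof.
apply/is_modelP => d; have [t d_t] : exists t, d.1 = t by exists d.1.
have reg_d r : count_at d same_class (reg_name r) = (conf t).2 r.
  by have [_] := @run_count d 0 t (congr1 (a \o val) d_t); apply.
apply/obeys_program; split.
- rewrite /obeys all_seq1; apply/implyP; rewrite mem_input inE d_t => /eqP t0.
  by rewrite reg_d t0.
- apply/obeys_base; split.
  + by apply: mem_defined (aw_touched d.1).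
  + by apply: mem_defined (aw_touched d.1.+1).
  + by apply/set0Pn; exists (ord0, ord0); rewrite inE.
  + rewrite !inE d_t => /eqP t0; rewrite t0; split=> // -[//|r] _.
    by rewrite reg_d t0.
- move=> pc i pc_i.
  have [d_pc|] := boolP (d \in concept_interp run_interp (state_name pc));
    last exact: obeys_instr_off.
  apply: (obeys_instr d_pc (ltn_reg_bound pc_i) (fun r _ => reg_d r)).2.
  have conf_pc : (conf t).1 = pc.
    by move: d_pc; rewrite inE /= odd_double /= uphalf_double d_t => /eqP.
  have lt_t : t < n.
    rewrite ltnNge; apply/negP => le_t; have t_n : t = n :> nat.
      by apply/eqP; rewrite eqn_leq le_t -ltnS ltn_ord.
    by move: halted; rewrite leqNgt -t_n -/(conf t) conf_pc -onthTE pc_i.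
  have -> : exec_instr i (pc, (conf t).2) = conf t.+1.
    rewrite /conf iterS -/(conf t) (step_onth (i := i)) ?conf_pc //.
    by rewrite -conf_pc -surjective_pairing.
  have [clk_d _] := @run_count d 0 t (congr1 (a \o val) d_t).
  have [] := @run_count d 1 (Ordinal (lt_t : t.+1 < n.+1))
    (congr1 (a \o succn \o val) d_t).
  rewrite -/next_class => clk_d' reg_d'; split=> [||r _]; last exact: reg_d'.
    by rewrite clk_d clk_d' ltn_sub2l.
  apply/set0Pn; exists (Ordinal (lt_t : t.+1 < n.+1), ord0); rewrite inE.
  apply/andP; split; last by rewrite inE /= odd_double /= uphalf_double.
  apply/(mem_class (x := a t.+1) (y := a t.+1)) => //.
  by rewrite /= /run_feature /= d_t.
Qed.

End RunModel.

Lemma halts_model (a w : nat -> D) p x : injective a ->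
  (forall k, touched (pair_env (a k) (w k)) phi) ->
  halts p x -> consistent (input_ci x :: program_tbox p).
Proof.
move=> a_inj aw [n n_halts].
by exists (run_interp p x n a w); apply: run_is_model.
Qed.

Lemma computable_input_code : computable (fun x =>
  num [:: code_concept (input_ci x).1; code_concept (input_ci x).2]).
Proof.
have code1 : computable (fun x => num [:: x]).
  rewrite (_ : (fun x => _) = expn 2); first exact: computable_exp2.
  by apply/funext => x; rewrite /= muln1.
have cons_code k f : computable (fun x => num (f x)) ->
    computable (fun x => num (k :: f x)).
  exact: computable_comp (computable_code_cons k).
have wrap f : computable f -> computable (fun x => num [:: f x]).
  exact: computable_comp code1.
pose e := code_pa_expr (code_set_var (@code_concept D))
  (count_plus same_class (reg_name 0) 0).
rewrite (_ : (fun x => _) = (fun x => num [:: code_concept (CName D start_name);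
  num [:: 4; num [:: 2; e; num [:: 0; x]]]])) //.
apply/cons_code/wrap/cons_code/wrap/cons_code/cons_code/wrap/cons_code.
exact: code1.
Qed.

End Encoding.

Lemma code_tbox_cons (D : concrete_domain) (ci : concept D * concept D) T :
  code_tbox (ci :: T) =
  2 ^ num [:: code_concept ci.1; code_concept ci.2] * (code_tbox T).*2.+1.
Proof. by []. Qed.

Theorem theorem5 (D : concrete_domain) (D_infinite : infinite_domain D)
    (D_JD : JD D) :
  ~ decidable_problem (@code_tbox D) (@consistent D).
Proof.
move=> [p p_dec]; have [phi phi_eq] := D_JD.
have [a [w [a_inj aw]]] := touched_injection D_infinite phi_eq.
have [pre pre_runs] := pair_program (computable_input_code phi).
set Q := pseq (pseq pre p) flip.
have := p_dec
  (input_ci phi (code_tbox (program_tbox phi Q)) :: program_tbox phi Q).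
rewrite code_tbox_cons; move: (code_tbox _) => x [T_yes T_no].
have [T_cons|T_incons] :=
  EM (consistent (input_ci phi x :: program_tbox phi Q)).
  have [m p_m m1] := outputs_runs (T_yes T_cons).
  have [I I_model] := T_cons.
  have Q_m := runs_pseq (pre_runs x) p_m.
  exact: not_halts_pseq_flip Q_m m1 (model_halts phi_eq I_model).
have [m p_m m0] := outputs_runs (T_no T_incons).
have Q_m := runs_pseq (pre_runs x) p_m.
exact/T_incons/(halts_model phi_eq a_inj aw)/(halts_pseq_flip Q_m m0).
Qed.
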